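(* Let $G:\mathbb{R}^n\to\mathbb{R}^n$, let $m\ge 1$ be an integer, $\lambda\in(0,1)$, $\mathbf{u}_0\in\mathbb{R}^n$, and let $\{\mathbf{u}_k\}$ be the (infinite) sequence generated by the algorithm GlobAA($m$) with the parameter choice $$\gamma_k=1-\max\left\{\frac{1}{k+2},\frac{W_k}{2W_0}\right\},\qquad W_k:=\max_{0\le j\le m_k}\|F_{k-m_k+j}\|,\qquad k\ge 0.$$ (1) If $G$ is nonexpansive on $\mathbb{R}^n$ (i.e. $\|G(\mathbf{u})-G(\mathbf{v})\|\le\|\mathbf{u}-\mathbf{v}\|$ for all $\mathbf{u},\mathbf{v}\in\mathbb{R}^n$) and has a fixed point, then $\|F(\mathbf{u}_k)\|\to 0$ as $k\to\infty$. (2) Suppose $G$ is nonexpansive on $\mathbb{R}^n$ and has a fixed point $\mathbf{u}^*$, and that $G$ is contractive with factor $c\in(0,1)$ in a neighborhood $D$ of $\mathbf{u}^*$, i.e. $\|G(\mathbf{u})-G(\mathbf{v})\|\le c\|\mathbf{u}-\mathbf{v}\|$ for all $\mathbf{u},\mathbf{v}\in D$. Then $\mathbf{u}^*$ is the unique fixed point of $G$. Moreover, if in addition $G$ is differentiable at $\mathbf{u}^*$ and the coefficients $\{\alpha_j^k\}_{j=0}^{m_k}$ satisfy, for all $k\ge 1$: (a) $\big\|\sum_{j=0}^{m_k}\alpha_j^kF_{k-m_k+j}\big\|\le\|F_k\|$; (b) $\sum_{j=0}^{m_k}\alpha_j^k=1$; (c) $\sum_{j=0}^{m_k}|\alpha_j^k|\le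 M_\alpha$ for some constant $M_\alpha\ge 1$ independent of $k$; then the following hold: - $\|F(\mathbf{u}_k)\|\to 0$ and $\mathbf{u}_k\to\mathbf{u}^*$ as $k\to\infty$, and there exists $K_0\in\mathbb{N}$ such that for every $k\ge K_0$ the acceptance condition $\|F(\mathbf{u}_{\rm AA}^{k+1})\|\le\gamma_k\max_{0\le j\le m_k}\|F_{k-m_k+j}\|$ is satisfied, so that $\mathbf{u}_{k+1}=\mathbf{u}_{\rm AA}^{k+1}$ for all $k\ge K_0$ (the iterates coincide with those of pure Anderson acceleration thereafter); - $\displaystyle\limsup_{k\to\infty}\left(\frac{\|F(\mathbf{u}_k)\|}{\|F(\mathbf{u}_0)\|}\right)^{1/k}\le c$ and $\displaystyle\limsup_{k\to\infty}\left(\frac{\|\mathbf{u}_k-\mathbf{u}^*\|}{\|\mathbf{u}_0-\mathbf{u}^*\|}\right)^{1/k}\le c$; - if $m=1$, then $\displaystyle\limsup_{k\to\infty}\frac{\|F(\mathbf{u}_{k+1})\|}{\|F(\mathbf{u}_k)\|}\le c$.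
   Context: $\|\cdot\|$ is the Euclidean norm on $\mathbb{R}^n$. For $G:\mathbb{R}^n\to\mathbb{R}^n$ the residual mapping is $F(\mathbf{u}):=G(\mathbf{u})-\mathbf{u}$. Algorithm GlobAA($m$). Inputs: $\mathbf{u}_0\in\mathbb{R}^n$, a positive integer $m$, a relaxation parameter $\lambda$ (here $\lambda\in(0,1)$), and a rule for choosing $\gamma_k$. Initialize $k=0$, $\kappa=0$. While $\|F(\mathbf{u}_k)\|>0$, do the following. (1) Set $m_k=\min\{m,k-\kappa\}$, $G_k=G(\mathbf{u}_k)$, $F_k=G_k-\mathbf{u}_k$, and choose $\gamma_k$. (2) Let $(\alpha_0^k,\dots,\alpha_{m_k}^k)$ be a solution of $\min\big\|\sum_{j=0}^{m_k}\alpha_jF_{k-m_k+j}\big\|$ subject to $\sum_{j=0}^{m_k}\alpha_j=1$, and set $\mathbf{u}_{\rm AA}^{k+1}=\sum_{j=0}^{m_k}\alpha_j^kG_{k-m_k+j}$. (3) If $\|F(\mathbf{u}_{\rm AA}^{k+1})\|\le\gamma_k\max_{0\le j\le m_k}\|F_{k-m_k+j}\|$ (acceptance condition), set $\mathbf{u}_{k+1}=\mathbf{u}_{\rm AA}^{k+1}$ (Anderson step, $\kappa$ unchanged); otherwise set $\mathbf{u}_{k+1}=(1-\lambda)\mathbf{u}_k+\lambda G_k$ and reset $\kappa=k+1$ (Krasnosel'skii–Mann step). (4) Replace $k$ by $k+1$. When $m=1$ and $m_k=1$, writing $(\alpha_0^k,\alpha_1^k)=(\alpha^k,1-\alpha^k)$,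 the solution of the subproblem is $\alpha^k=\dfrac{F_k^\top(F_k-F_{k-1})}{\|F_k-F_{k-1}\|^2}$ if $F_k\ne F_{k-1}$, and the convention $\alpha^k=0$ is used if $F_k=F_{k-1}$. Standing assumption: the algorithm never stops, i.e. $F(\mathbf{u}_k)\ne 0$ for all $k\ge 0$, so that an infinite sequence is generated. *)

(* Defs.v *)
From HB Require Import structures.
From mathcomp Require Import all_boot all_order all_algebra.
From mathcomp Require Import all_classical all_reals all_analysis.

Set Implicit Arguments.
Unset Strict Implicit.
Unset Printing Implicit Defensive.

Import Order.TTheory GRing.Theory Num.Theory.
Import numFieldNormedType.Exports.

Local Open Scope ring_scope.

(* The library norm on matrices is the sup norm; it induces the same topology
   (and the same notion of differentiability) as this one, but the contraction
   constants and the least-squares problems below are Euclidean. *)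
Definition enorm (R : realType) (n : nat) (v : 'cV[R]_n) : R :=
  Num.sqrt (\sum_(i < n) v i 0 ^+ 2).

Definition nonexpansive (R : realType) (n : nat)
    (G : 'cV[R]_n -> 'cV[R]_n) : Prop :=
  forall u v, enorm (G u - G v) <= enorm (u - v).

Definition contractive_on (R : realType) (n : nat)
    (G : 'cV[R]_n -> 'cV[R]_n) (D : set 'cV[R]_n) (c : R) : Prop :=
  forall u v, D u -> D v -> enorm (G u - G v) <= c * enorm (u - v).

Definition residual (R : realType) (n : nat) (G : 'cV[R]_n -> 'cV[R]_n)
    (u : 'cV[R]_n) : 'cV[R]_n := G u - u.

Section GlobAA.

Variables (R : realType) (n : nat) (G : 'cV[R]_n -> 'cV[R]_n) (m : nat).

(* [kappa k] is the value of the restart index when iteration [k] starts. *)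
Variables (u : nat -> 'cV[R]_n) (kappa : nat -> nat).

Definition depth (k : nat) : nat := minn m (k - kappa k).

(* Only the values [a j] with [j <= depth k] matter; column [j] of the history
   window at iteration [k] is the iterate of index [k - depth k + j]. *)
Definition AA_residual (k : nat) (a : nat -> R) : 'cV[R]_n :=
  \sum_(j < (depth k).+1) a j *: residual G (u (k - depth k + j)%N).

Definition AA_update (k : nat) (a : nat -> R) : 'cV[R]_n :=
  \sum_(j < (depth k).+1) a j *: G (u (k - depth k + j)%N).

(* The default value 0 of the maximum is harmless: norms are nonnegative. *)
Definition window_max (k : nat) : R :=
  \big[Num.max/0]_(j < (depth k).+1)
    enorm (residual G (u (k - depth k + j)%N)).

Definition AA_solution (k : nat) (a : nat -> R) : Prop :=
  \sum_(j < (depth k).+1) a j = 1 /\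
  forall b : nat -> R, \sum_(j < (depth k).+1) b j = 1 ->
    enorm (AA_residual k a) <= enorm (AA_residual k b).

Variables (alpha : nat -> nat -> R) (gamma : nat -> R).

Definition u_AA (k : nat) : 'cV[R]_n := AA_update k (alpha k).

Definition AA_accepted (k : nat) : bool :=
  enorm (residual G (u_AA k)) <= gamma k * window_max k.

Variables (lambda : R) (u0 : 'cV[R]_n).

(* [GlobAA_degenerate] resolves the non-uniqueness of the least-squares
   solution for [m = 1]; otherwise any solution may be chosen. *)
Record GlobAA : Prop := {
  GlobAA_u0 : u 0%N = u0;
  GlobAA_kappa0 : kappa 0%N = 0%N;
  GlobAA_alpha : forall k, AA_solution k (alpha k);
  GlobAA_degenerate : forall k, m = 1%N -> depth k = 1%N ->
    residual G (u k) = residual G (u k.-1) -> alpha k 0%N = 0;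
  GlobAA_u : forall k, u k.+1 =
    if AA_accepted k then u_AA k
    else (1 - lambda) *: u k + lambda *: G (u k);
  GlobAA_kappa : forall k, kappa k.+1 =
    if AA_accepted k then kappa k else k.+1 }.

End GlobAA.

(* Main.v *)
Require Import Defs.
From HB Require Import structures.
From mathcomp Require Import all_boot all_order all_algebra.
From mathcomp Require Import all_classical all_reals all_analysis.
From mathcomp Require Import ring lra zify.

Set Implicit Arguments.
Unset Strict Implicit.
Unset Printing Implicit Defensive.

Import Order.TTheory GRing.Theory Num.Theory.
Import numFieldNormedType.Exports.

Local Open Scope classical_set_scope.
Local Open Scope ring_scope.

(** The algorithm is safeguarded: an accepted step has a residual at most
    [gamma k] times the largest residual [W k] of the history window, and a
    rejected one is a Krasnosel'skii-Mann step, which does not increase the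
    residual of a nonexpansive map and restarts the window.  Hence [W] is
    nonincreasing ([window_max_noninc]).

    For global convergence, suppose that the limit [l] of [W] is positive.  The
    term [W k / (2 * W 0)] in [gamma k] then keeps [gamma k] below a fixed
    [g < 1].  From any time [K] on, [W] eventually falls below [g * W K]
    ([window_max_contracts]): either an accepted step is followed by a restart,
    or accepted steps go on until they fill the window, or all steps are of
    Krasnosel'skii-Mann type and their residuals tend to [0] by Fejer
    monotonicity.  So [l <= g * l], which is absurd.

    For the local part, contractivity near the fixed point [us], spread to the
    whole space by nonexpansiveness, gives
    [enorm (u - us) <= enorm (residual G u) / (1 - c)] as soon as the residual
    is small ([dist_le_residual]); so small residuals mean closeness to [us],
    which yields both uniqueness of the fixed point and convergence of the
    iterates.  Differentiability at [us] then shows that the residual of an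
    accelerated step is [A] applied to the combined residual plus a remainder
    ([residual_combination]), where [A] is the derivative and has norm at most
    [c].  Since the combined residual is at most the current one,
    [r k.+1 <= c * r k + e * S k] with [e] as small as desired and [S k] the sum
    of the window residuals weighted by the absolute values of the coefficients
    ([accelerated_residual]).

    Everything else follows from this inequality.  As [S k <= M * W k] and
    [gamma k] tends to [1], every late step is accepted ([near_accepted]).  The
    small delayed term does not spoil the exponential rate
    ([geometric_decay]), so the root rates are at most [c].  For windows of
    length at most two, [S k] is at most a constant times the current residual
    alone ([weighted_residual_le_depth1]), so the rate is [c] at every step. *)

(** * The Euclidean norm on column vectors *)

Section EuclideanNorm.
Variables (R : realType) (n : nat).
Implicit Types u v w : 'cV[R]_n.

Lemma enorm_ge0 v : 0 <= enorm v.
Proof. exact: sqrtr_ge0. Qed.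

Lemma sqr_enorm v : enorm v ^+ 2 = \sum_(i < n) v i 0 ^+ 2.
Proof. by rewrite sqr_sqrtr// sumr_ge0// => i _; rewrite sqr_ge0. Qed.

Lemma enorm_le v x : 0 <= x ->
  \sum_(i < n) v i 0 ^+ 2 <= x ^+ 2 -> enorm v <= x.
Proof. by move=> x0; rewrite -sqr_enorm ler_sqr// nnegrE ?enorm_ge0. Qed.

Lemma enormZ a v : enorm (a *: v) = `|a| * enorm v.
Proof.
rewrite /enorm -sqrtr_sqr -sqrtrM ?sqr_ge0//; congr (Num.sqrt _).
by rewrite mulr_sumr; apply: eq_bigr => i _; rewrite mxE exprMn.
Qed.

Lemma enormN v : enorm (- v) = enorm v.
Proof. by rewrite -scaleN1r enormZ normrN1 mul1r. Qed.

Lemma enormB v w : enorm (v - w) = enorm (w - v).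
Proof. by rewrite -enormN opprB. Qed.

Lemma enorm0 : enorm (0 : 'cV[R]_n) = 0.
Proof. by rewrite -(scale0r 0) enormZ normr0 mul0r. Qed.

Lemma enorm_eq0 v : enorm v = 0 -> v = 0.
Proof.
move=> v0; apply/matrixP => i j; rewrite ord1 mxE; apply/eqP.
rewrite -sqrf_eq0; apply/eqP; move: (sqr_enorm v); rewrite v0 expr0n/= => /esym.
by move/psumr_eq0P => /(_ (fun i _ => sqr_ge0 (v i 0)))/(_ i isT).
Qed.

Lemma enorm_gt0 v : v <> 0 -> 0 < enorm v.
Proof.
move=> v0; rewrite lt_neqAle enorm_ge0 andbT; apply/eqP => /esym.
by move/enorm_eq0.
Qed.

Lemma sum_mul_le_enorm v w : \sum_(i < n) v i 0 * w i 0 <= enorm v * enorm w.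
Proof.
have [v0|/eqP v0] := eqVneq v 0.
  by rewrite v0 enorm0 mul0r big1// => i _; rewrite mxE mul0r.
have [w0|/eqP w0] := eqVneq w 0.
  by rewrite w0 enorm0 mulr0 big1// => i _; rewrite mxE mulr0.
have a0 := enorm_gt0 v0; have b0 := enorm_gt0 w0.
set a := enorm v in a0 *; set b := enorm w in b0 *.
(* the sum of squares of the entries of [b v - a w] is nonnegative *)
have : 0 <= \sum_(i < n) (b * v i 0 - a * w i 0) ^+ 2.
  by apply: sumr_ge0 => i _; rewrite sqr_ge0.
have -> : \sum_(i < n) (b * v i 0 - a * w i 0) ^+ 2 =
    2 * (a * b) * (a * b - \sum_(i < n) v i 0 * w i 0).
  rewrite mulrBr mulr_sumr.
  transitivity (b ^+ 2 * \sum_(i < n) v i 0 ^+ 2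
      + a ^+ 2 * \sum_(i < n) w i 0 ^+ 2
      - \sum_(i < n) 2 * (a * b) * (v i 0 * w i 0)).
    rewrite !mulr_sumr -big_split/= -sumrB; apply: eq_bigr => i _; ring.
  rewrite -!sqr_enorm -/a -/b; ring.
by rewrite pmulr_rge0 ?subr_ge0// !mulr_gt0.
Qed.

Lemma enormD v w : enorm (v + w) <= enorm v + enorm w.
Proof.
apply: enorm_le; first by rewrite addr_ge0 ?enorm_ge0.
have -> : \sum_(i < n) (v + w) i 0 ^+ 2 =
    \sum_(i < n) v i 0 ^+ 2 + \sum_(i < n) w i 0 ^+ 2
    + 2 * \sum_(i < n) v i 0 * w i 0.
  rewrite mulr_sumr -!big_split/=; apply: eq_bigr => i _; rewrite !mxE; ring.
rewrite -!sqr_enorm; have := sum_mul_le_enorm v w; lra.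
Qed.

Lemma enormBD v w : enorm (v - w) <= enorm v + enorm w.
Proof. by apply: le_trans (enormD _ _) _; rewrite enormN. Qed.

Lemma enorm_distD w u v : enorm (u - v) <= enorm (u - w) + enorm (w - v).
Proof. by have := enormD (u - w) (w - v); rewrite addrA subrK. Qed.

Lemma enorm_sum (p : nat) (a : nat -> R) (x : nat -> 'cV[R]_n) :
  enorm (\sum_(j < p) a j *: x j) <= \sum_(j < p) `|a j| * enorm (x j).
Proof.
elim: p => [|p IH]; first by rewrite !big_ord0 enorm0.
rewrite !big_ord_recr/=; apply: le_trans (enormD _ _) _.
by rewrite lerD// enormZ.
Qed.

(** This identity is where the Krasnosel'skii-Mann step gains: the last term is
    the amount by which relaxation brings the iterate closer to a fixed point.
*)
Lemma sqr_enorm_convex (t : R) v w :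
  enorm ((1 - t) *: v + t *: w) ^+ 2 =
  (1 - t) * enorm v ^+ 2 + t * enorm w ^+ 2 - t * (1 - t) * enorm (w - v) ^+ 2.
Proof.
rewrite !sqr_enorm !mulr_sumr -big_split/= -sumrB.
by apply: eq_bigr => i _; rewrite !mxE; ring.
Qed.

Lemma coord_le_enorm v i : `|v i 0| <= enorm v.
Proof.
rewrite -ler_sqr ?nnegrE ?enorm_ge0// sqr_enorm real_normK ?num_real//.
by rewrite (bigD1 i)//= lerDl sumr_ge0// => j _; rewrite sqr_ge0.
Qed.

Lemma norm_le_enorm v : `|v| <= enorm v.
Proof.
rewrite [`|v|]mx_normrE; apply: bigmax_le; first exact: enorm_ge0.
by move=> [i j] _ /=; rewrite ord1 coord_le_enorm.
Qed.

(** Crude, but it is enough to transfer the small remainder of a differentiable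
    map from the norm of the topology to the Euclidean one. *)
Lemma enorm_le_norm v : enorm v <= n%:R * `|v|.
Proof.
apply: enorm_le; first by rewrite mulr_ge0.
apply: (@le_trans _ _ (\sum_(i < n) `|v| ^+ 2)).
  apply: ler_sum => i _; rewrite -[v i 0 ^+ 2]real_normK ?num_real//.
  rewrite ler_sqr ?nnegrE// [`|v|]mx_normrE.
  exact: (le_bigmax _ (fun ij => `|v ij.1 ij.2|) (i, 0)).
rewrite sumr_const card_ord exprMn -[leLHS]mulr_natl ler_wpM2r ?sqr_ge0//.
by rewrite -natrX ler_nat; case: n => // k; rewrite expnS leq_pmulr.
Qed.

End EuclideanNorm.

(** * Residuals near a contractive fixed point *)

Section LocalAnalysis.
Variables (R : realType) (n : nat) (G : 'cV[R]_n -> 'cV[R]_n).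
Variables (us : 'cV[R]_n) (c : R).
Implicit Types (rho delta e : R) (v w h : 'cV[R]_n).
Hypothesis neG : nonexpansive G.
Hypothesis fix_us : G us = us.
Hypothesis c01 : 0 < c < 1.

Lemma nbhs_enorm_ball (D : set 'cV[R]_n) : nbhs us D ->
  exists2 rho : R, 0 < rho & forall v, enorm (v - us) <= rho -> D v.
Proof.
move=> /nbhs_ballP[e /= e0 eD]; exists (e / 2); first by rewrite divr_gt0.
move=> v vr; apply: eD; rewrite -ball_normE /ball_/= distrC.
apply: le_lt_trans (norm_le_enorm _) _; apply: le_lt_trans vr _; lra.
Qed.

Lemma contractive_near_fixpoint D : nbhs us D -> contractive_on G D c ->
  exists2 rho : R, 0 < rho &
    forall v, enorm (v - us) <= rho -> enorm (G v - us) <= c * enorm (v - us).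
Proof.
move=> nD cD; have [rho rho0 rD] := nbhs_enorm_ball nD.
exists rho => // v vr; rewrite -{1}fix_us; apply: cD; first exact: rD.
exact: nbhs_singleton.
Qed.

(** Outside the ball of contraction, compare [v] with the point [w] where the
    segment from [us] to [v] leaves the ball: [G] brings [w] closer to [us] by
    [(1 - c) * rho] and does not stretch the rest of the segment, so the
    residual at [v] is at least [(1 - c) * rho]. *)
Lemma dist_le_residual rho v : 0 < rho ->
  (forall w, enorm (w - us) <= rho -> enorm (G w - us) <= c * enorm (w - us)) ->
  enorm (residual G v) < (1 - c) * rho ->
  enorm (v - us) <= enorm (residual G v) / (1 - c).
Proof.
move=> rho0 contr; have /andP[c0 c1] := c01; rewrite /residual => small.
have tri : enorm (v - us) <= enorm (G v - v) + enorm (G v - us).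
  by rewrite (enormB (G v) v); exact: enorm_distD.
have vr : enorm (v - us) <= rho.
  rewrite leNgt; apply/negP => far; have d0 := lt_trans rho0 far.
  pose t := rho / enorm (v - us); pose w := us + t *: (v - us).
  have t0 : 0 <= t by rewrite divr_ge0// ltW.
  have t1 : t <= 1 by rewrite ler_pdivrMr// mul1r ltW.
  have td : t * enorm (v - us) = rho by rewrite divfK// gt_eqF.
  have wus : enorm (w - us) = rho by rewrite /w addrC addKr enormZ ger0_norm.
  have vw : enorm (v - w) = enorm (v - us) - rho.
    have -> : v - w = (1 - t) *: (v - us).
      by apply/matrixP => i j; rewrite !mxE; ring.
    by rewrite enormZ ger0_norm ?subr_ge0// -td; ring.
  have := contr w; rewrite wus lexx => /(_ isT).
  have := neG v w; rewrite vw; have := enorm_distD (G w) (G v) us; lra.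
by rewrite ler_pdivlMr ?subr_gt0//; have := contr v vr; lra.
Qed.

Lemma fixpoint_unique rho v : 0 < rho ->
  (forall w, enorm (w - us) <= rho -> enorm (G w - us) <= c * enorm (w - us)) ->
  G v = v -> v = us.
Proof.
move=> rho0 contr fix_v; have /andP[c0 c1] := c01.
have := dist_le_residual rho0 contr; move=> /(_ v).
rewrite /residual fix_v subrr enorm0 mul0r mulr_gt0 ?subr_gt0// => /(_ isT) d0.
apply/eqP; rewrite -subr_eq0; apply/eqP; apply: enorm_eq0.
by apply/eqP; rewrite eq_le d0 enorm_ge0.
Qed.

Lemma differentiable_enorm : differentiable G us -> forall e, 0 < e ->
  exists2 delta : R, 0 < delta & forall h, enorm h <= delta ->
    enorm (G (us + h) - us - 'd G us h) <= e * enorm h.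
Proof.
move=> dG e e0.
(* the Euclidean norm is at most [n] times the norm of the topology *)
pose e' := e / n.+1%:R.
have e'0 : 0 < e' by rewrite divr_gt0.
have /eqaddoP/(_ _ e'0) := diff_locally dG.
move=> /nbhs_ballP[d /= d0 dh]; exists (d / 2); first by rewrite divr_gt0.
move=> h hd; have hball : ball (0 : 'cV[R]_n) d h.
  rewrite -ball_normE /ball_/= sub0r normrN.
  apply: le_lt_trans (norm_le_enorm _) _; lra.
have hh : `|G (h + us) - (G us + 'd G us h)| <= e' * `|h| := dh _ hball.
rewrite -{2}fix_us -addrA -opprD addrC [us + h]addrC addrC.
apply: le_trans (enorm_le_norm _) _; apply: le_trans (ler_wpM2l _ hh) _ => //.
have -> : n%:R * (e' * `|h|) = n%:R / n.+1%:R * (e * `|h|).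
  by rewrite /e' !mulrA; congr (_ * _); rewrite mulrAC.
apply: (@le_trans _ _ (e * `|h|)); last by rewrite ler_pM2l// norm_le_enorm.
rewrite ler_piMl ?mulr_ge0 ?(ltW e0)//.
by rewrite ler_pdivrMr// mul1r ler_nat.
Qed.

(** The derivative is tested on vectors scaled into the ball, where the
    remainder is a small multiple of their length. *)
Lemma diff_contraction rho : differentiable G us -> 0 < rho ->
  (forall w, enorm (w - us) <= rho -> enorm (G w - us) <= c * enorm (w - us)) ->
  forall h, enorm ('d G us h) <= c * enorm h.
Proof.
move=> dG rho0 contr h; have [->|/eqP h0] := eqVneq h 0.
  by rewrite linear0 enorm0 mulr0.
have hgt0 := enorm_gt0 h0; apply/ler_addgt0Pr => e e0.
have [|delta delta0 dh] := differentiable_enorm dG (e := e / enorm h).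
  by rewrite divr_gt0.
pose s := Num.min delta rho / enorm h.
have s0 : 0 < s by rewrite divr_gt0// lt_min delta0 rho0.
have sh : enorm (s *: h) = Num.min delta rho.
  by rewrite enormZ gtr0_norm// divfK// gt_eqF.
have := dh (s *: h); rewrite sh ge_min lexx => /(_ isT) rem.
have := contr (us + s *: h); rewrite addrC addKr sh ge_min lexx orbT.
move=> /(_ isT) ctr.
have : enorm ('d G us (s *: h)) <=
    c * Num.min delta rho + e / enorm h * Num.min delta rho.
  apply: le_trans (lerD ctr rem); rewrite [us + _]addrC.
  set x := G _ - us; set y := 'd G us _.
  by rewrite -{1}(subKr x y); exact: enormBD.
rewrite linearZ/= enormZ gtr0_norm// -sh enormZ gtr0_norm//.
have -> : c * (s * enorm h) + e / enorm h * (s * enorm h) =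
    s * (c * enorm h + e) by field; rewrite gt_eqF.
by rewrite ler_pM2l.
Qed.

(** Writing [G (us + h) = us + A h + rem h], the residual at the affine
    combination [us + z] of the images [G (x j)] is exactly
    [A (\sum_j a j *: residual G (x j)) - \sum_j a j *: rem (x j - us) + rem z]:
    to first order an accelerated step multiplies the combined residual by [A],
    and every term besides is a remainder.  The size of these is measured by
    the weights [`|a j|], not by the largest distance alone; the rate for a
    window of length two depends on this. *)
Lemma residual_combination (A : {linear 'cV[R]_n -> 'cV[R]_n}) e delta p
    (a : nat -> R) (x : nat -> 'cV[R]_n) :
  (forall h, enorm (A h) <= c * enorm h) -> 0 <= e ->
  (forall h, enorm h <= delta ->
    enorm (G (us + h) - us - A h) <= e * enorm h) ->
  \sum_(j < p) a j = 1 ->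
  (forall j, (j < p)%N -> enorm (x j - us) <= delta) ->
  \sum_(j < p) `|a j| * enorm (x j - us) <= delta ->
  enorm (residual G (\sum_(j < p) a j *: G (x j))) <=
    c * enorm (\sum_(j < p) a j *: residual G (x j))
    + 2 * e * \sum_(j < p) `|a j| * enorm (x j - us).
Proof.
move=> cA e0 rem_small suma xd; set S := \sum_(j < p) `|a j| * _ => Sd.
pose rem h := G (us + h) - us - A h.
pose z := \sum_(j < p) a j *: (G (x j) - us).
have yE : \sum_(j < p) a j *: G (x j) = us + z.
  rewrite /z; under [X in us + X]eq_bigr do rewrite scalerBr.
  by rewrite sumrB -scaler_suml suma scale1r addrC subrK.
have zS : enorm z <= S.
  apply: le_trans (enorm_sum _ _ (fun j => G (x j) - us)) _.
  by apply: ler_sum => j _; rewrite ler_wpM2l// -{1}fix_us; exact: neG.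
have AzE : A z = A (\sum_(j < p) a j *: residual G (x j))
    + \sum_(j < p) a j *: A (x j - us).
  rewrite !linear_sum/= -big_split/=; apply: eq_bigr => j _.
  rewrite !linearZ/= -scalerDr -linearD; congr (_ *: A _).
  by rewrite /residual addrA subrK.
have sum_rem : \sum_(j < p) a j *: rem (x j - us) =
    z - \sum_(j < p) a j *: A (x j - us).
  rewrite -sumrB; apply: eq_bigr => j _.
  by rewrite /rem -scalerBr [us + _]addrC subrK.
have -> : residual G (\sum_(j < p) a j *: G (x j)) =
    A (\sum_(j < p) a j *: residual G (x j))
    - \sum_(j < p) a j *: rem (x j - us) + rem z.
  rewrite sum_rem yE /residual /rem AzE.
  by apply/matrixP => i k; rewrite !mxE; ring.
apply: le_trans (enormD _ _) _; apply: le_trans (lerD (enormBD _ _) (lexx _)) _.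
have := cA (\sum_(j < p) a j *: residual G (x j)).
have : enorm (rem z) <= e * S.
  apply: le_trans (rem_small _ (le_trans zS Sd)) _; exact: ler_wpM2l.
have : enorm (\sum_(j < p) a j *: rem (x j - us)) <= e * S.
  apply: le_trans (enorm_sum _ _ (fun j => rem (x j - us))) _.
  rewrite /S mulr_sumr; apply: ler_sum => j _; rewrite mulrCA ler_wpM2l//.
  exact/rem_small/xd.
lra.
Qed.

End LocalAnalysis.

(** * Exponential rates of real sequences *)

Section Rates.
Variable R : realType.
Implicit Types (r w f : nat -> R) (a c e q x : R).

Lemma limn_esup_le f c : c < 1 ->
  (forall q, c < q -> q < 1 -> \forall k \near \oo, f k <= q) ->
  (limn_esup (fun k => (f k)%:E) <= c%:E)%E.
Proof.
move=> c1 h; apply/lee_addgt0Pr => e e0.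
pose q := Num.min (c + e) ((c + 1) / 2).
have cq : c < q by rewrite lt_min; apply/andP; split; lra.
have q1 : q < 1 by rewrite gt_min; apply/orP; right; lra.
apply: (@le_trans _ _ q%:E); last by rewrite -EFinD lee_fin ge_min lexx.
rewrite /limn_esup limf_esupE; apply: ereal_inf_le.
exists (ereal_sup ((fun k => (f k)%:E) @` [set k | f k <= q])).
  by exists [set k | f k <= q] => //; exact: h.
by apply: ge_ereal_sup => _ [k /= fk <-]; rewrite lee_fin.
Qed.

Lemma limn_esup_root_le r c a : 0 < c < 1 -> 0 < a -> (forall k, 0 <= r k) ->
  (forall q, c < q -> q < 1 ->
    exists C, \forall k \near \oo, r k <= C * q ^+ k) ->
  (limn_esup (fun k => ((r k / a) `^ k%:R^-1)%:E) <= c%:E)%E.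
Proof.
move=> /andP[c0 c1] a0 r0 geo; apply: limn_esup_le => // q cq q1.
have q0 := lt_trans c0 cq; pose p := (c + q) / 2.
have [|| C rC] := geo p; rewrite /p; [lra|lra|].
have p0 : 0 < p by rewrite /p; lra.
have pq : `|p / q| < 1.
  rewrite ger0_norm; last by rewrite divr_ge0// ltW.
  by rewrite ltr_pdivrMr// mul1r /p; lra.
have cvg0 : (fun k => (C / a) * (p / q) ^+ k) @ \oo --> (0 : R).
  by rewrite -[X in _ --> X](mulr0 (C / a)); apply: cvgMl_tmp; exact: cvg_expr.
have small : \forall k \near \oo, `|(C / a) * (p / q) ^+ k| <= 1.
  have /cvgr0Pnorm_le := cvg0; exact.
near=> k; have k0 : (0 < k)%N by near: k; exists 1%N.
have -> : q = (q ^+ k) `^ k%:R^-1.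
  rewrite -powR_mulrn ?(ltW q0)// -powRrM divff ?powRr1 ?(ltW q0)//.
  by rewrite pnatr_eq0 -lt0n.
apply: ge0_ler_powR; rewrite ?nnegrE ?divr_ge0 ?exprn_ge0 ?(ltW q0) ?(ltW a0)//.
apply: (@le_trans _ _ (C * p ^+ k / a)).
  by rewrite ler_pM2r ?invr_gt0//; near: k.
have -> : C * p ^+ k / a = (C / a) * (p / q) ^+ k * q ^+ k.
  rewrite [(p / q) ^+ k]expr_div_n -[RHS]mulrA divfK ?expf_neq0 ?gt_eqF//.
  by rewrite mulrAC.
rewrite ler_piMl ?exprn_ge0 ?(ltW q0)//.
by apply: le_trans (ler_norm _) _; near: k.
Unshelve. all: by end_near. Qed.

(** The delayed term costs only [q ^- m] relative to the current one when the
    sequence decays like [q ^+ k], so for [q > c] it is absorbed once [e] is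
    small enough. *)
Lemma geometric_decay r w c q e m K : 0 <= c -> 0 < q <= 1 -> 0 <= e ->
  e <= q ^+ m * (q - c) -> (forall k, 0 <= r k) ->
  (forall k x, 0 <= x -> (forall i, (k - m <= i <= k)%N -> r i <= x) ->
    w k <= x) ->
  (forall k, (K <= k)%N -> r k.+1 <= c * r k + e * w k) ->
  exists C, forall k, r k <= C * q ^+ k.
Proof.
move=> c0 /andP[q0 q1] e0 eq r0 wmax step; pose N := (K + m)%N.
have rq k : 0 <= r k / q ^+ k by rewrite divr_ge0// exprn_ge0// ltW.
pose C := \sum_(i < N.+1) r i / q ^+ i.
have C0 : 0 <= C by apply: sumr_ge0.
(* [C] is large enough for the first [N.+1] terms: the recurrence starts at [K]
   and reaches [m] steps back *)
exists C => k; have [j] := ubnP k; elim: j k => // j IH k kj.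
have [kN|Nk] := leqP k N.
  rewrite -ler_pdivrMr ?exprn_gt0// /C.
  rewrite (bigD1 (Ordinal (kN : (k < N.+1)%N)))//= lerDl.
  by apply: sumr_ge0.
case: k => // k in kj Nk *.
have Kk : (K <= k)%N by lia.
have mk : (m <= k)%N by lia.
pose x := C * q ^+ (k - m).
have x0 : 0 <= x by rewrite mulr_ge0// exprn_ge0// ltW.
have wx : w k <= x.
  apply: wmax => // i /andP[i1 i2]; apply: le_trans (IH _ _) _; first by lia.
  by rewrite ler_wpM2l// ler_wiXn2l// ltW.
have qk : C * q ^+ k = x * q ^+ m by rewrite /x -mulrA -exprD subnK.
have rk : r k <= x * q ^+ m by rewrite -qk; apply: IH; lia.
rewrite exprSr mulrA qk; apply: le_trans (step _ Kk) _.
have := ler_wpM2l c0 rk; have := ler_wpM2l e0 wx; have := ler_wpM2l x0 eq.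
lra.
Qed.

End Rates.

(** * The history window *)

Section Window.
Variables (R : realType) (n : nat) (G : 'cV[R]_n -> 'cV[R]_n) (m : nat).
Variables (u : nat -> 'cV[R]_n) (kappa : nat -> nat).

Local Notation r k := (enorm (residual G (u k))).
Local Notation d k := (depth m kappa k).
Local Notation W k := (window_max G m u kappa k).

Lemma depth_le k : (d k <= k)%N.
Proof. by rewrite (leq_trans (geq_minr _ _))// leq_subr. Qed.

Lemma depth_le_size k : (d k <= m)%N.
Proof. exact: geq_minl. Qed.

Lemma le_window_max k i : (k - d k <= i <= k)%N -> r i <= W k.
Proof.
move=> ik; have dk := depth_le k.
have ltj : (i - (k - d k) < (d k).+1)%N by lia.
rewrite /window_max (_ : i = (k - d k + Ordinal ltj)%N); last first.
  by rewrite /=; lia.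
exact: (le_bigmax _ (fun j : 'I__ => r (k - d k + j)) (Ordinal ltj)).
Qed.

Lemma entry_le_window_max k j : (j < (d k).+1)%N -> r (k - d k + j)%N <= W k.
Proof. by move=> jd; apply: le_window_max; have := depth_le k; lia. Qed.

Lemma window_max_ge0 k : 0 <= W k.
Proof. exact: bigmax_ge_id. Qed.

Lemma window_max_le k (x : R) : 0 <= x ->
  (forall i, (k - d k <= i <= k)%N -> r i <= x) -> W k <= x.
Proof.
move=> x0 h; apply: bigmax_le => // j _; apply: h.
by have := ltn_ord j; have := depth_le k; lia.
Qed.

End Window.

(** * Global convergence *)

Section GlobalConvergence.
Variables (R : realType) (n : nat) (G : 'cV[R]_n -> 'cV[R]_n) (m : nat).
Variables (u : nat -> 'cV[R]_n) (kappa : nat -> nat).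
Variables (alpha : nat -> nat -> R) (gamma : nat -> R).
Variables (lambda : R) (u0 : 'cV[R]_n).
Hypothesis lambda01 : 0 < lambda < 1.
Hypothesis run : GlobAA G m u kappa alpha gamma lambda u0.
Hypothesis gammaE : forall k : nat, gamma k =
  1 - Num.max (1 / (k + 2)%:R)
              (window_max G m u kappa k / (2 * window_max G m u kappa 0%N)).
Hypothesis nonstop : forall k : nat, residual G (u k) <> 0.
Hypothesis neG : nonexpansive G.

Local Notation r k := (enorm (residual G (u k))).
Local Notation d k := (depth m kappa k).
Local Notation W k := (window_max G m u kappa k).
Local Notation accepted k := (AA_accepted G m u kappa alpha gamma k).

Lemma restart_le k : (kappa k <= k)%N.
Proof.
elim: k => [|k IH]; first by rewrite (GlobAA_kappa0 run).
by rewrite (GlobAA_kappa run); case: ifP => // _; rewrite (leq_trans IH).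
Qed.

Lemma accepted_window_start k : accepted k -> (k - d k <= k.+1 - d k.+1)%N.
Proof.
move=> ok; rewrite /depth (GlobAA_kappa run) ok.
by have := restart_le k; lia.
Qed.

Lemma rejected_depth k : ~~ accepted k -> d k.+1 = 0%N.
Proof. by move=> /negbTE no; rewrite /depth (GlobAA_kappa run) no; lia. Qed.

Lemma residual_gt0 k : 0 < r k.
Proof. exact: enorm_gt0. Qed.

Lemma residual_le_window k : r k <= W k.
Proof. by apply: le_window_max; rewrite leqnn leq_subr. Qed.

Lemma window_max_gt0 k : 0 < W k.
Proof. by rewrite (lt_le_trans (residual_gt0 k))// residual_le_window. Qed.

Lemma gamma_le1 k : gamma k <= 1.
Proof. by rewrite gammaE lerBlDr lerDl le_max divr_ge0. Qed.

Lemma gamma_le k : gamma k <= 1 - W k / (2 * W 0%N).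
Proof. by rewrite gammaE lerB// le_max lexx orbT. Qed.

Lemma accepted_residual k : accepted k -> r k.+1 <= gamma k * W k.
Proof. by move=> ok; rewrite (GlobAA_u run) ok; exact: ok. Qed.

Lemma rejected_update k : ~~ accepted k ->
  u k.+1 = (1 - lambda) *: u k + lambda *: G (u k).
Proof. by move=> /negbTE no; rewrite (GlobAA_u run) no. Qed.

(** [G] moves the endpoint of the step by at most its length [lambda * r k],
    and the part [(1 - lambda) * r k] of the old residual is left over. *)
Lemma rejected_residual k : ~~ accepted k -> r k.+1 <= r k.
Proof.
move=> no; have /andP[l0 l1] := lambda01; rewrite (rejected_update no).
set v := _ + _; rewrite /residual.
apply: le_trans (enorm_distD (G (u k)) _ _) _.
have -> : G (u k) - v = (1 - lambda) *: (G (u k) - u k).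
  by apply/matrixP => i j; rewrite !mxE; ring.
have : enorm (G v - G (u k)) <= lambda * enorm (G (u k) - u k).
  apply: le_trans (neG _ _) _.
  have -> : v - u k = lambda *: (G (u k) - u k).
    by apply/matrixP => i j; rewrite !mxE; ring.
  by rewrite enormZ gtr0_norm.
have := enorm_ge0 (G (u k) - u k).
rewrite enormZ gtr0_norm ?subr_gt0//; lra.
Qed.

Lemma residualS_le_window k : r k.+1 <= W k.
Proof.
have [ok|no] := boolP (accepted k).
  apply: le_trans (accepted_residual ok) _.
  by rewrite ler_piMl ?window_max_ge0 ?gamma_le1.
by rewrite (le_trans (rejected_residual no))// residual_le_window.
Qed.

Lemma rejected_window k : ~~ accepted k -> W k.+1 <= r k.
Proof.
move=> no; apply: window_max_le; first exact: enorm_ge0.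
move=> i; rewrite (rejected_depth no) subn0 -eqn_leq => /eqP <-.
exact: rejected_residual.
Qed.

Lemma window_max_noninc k : W k.+1 <= W k.
Proof.
have [ok|no] := boolP (accepted k); last first.
  by rewrite (le_trans (rejected_window no))// residual_le_window.
apply: window_max_le; first exact: window_max_ge0.
move=> i /andP[ki]; rewrite leq_eqVlt => /predU1P[->|ik].
  exact: residualS_le_window.
by apply: le_window_max; rewrite (leq_trans (accepted_window_start ok) ki).
Qed.

Lemma window_max_homo : {homo (fun k => W k) : k l / (k <= l)%N >-> l <= k}.
Proof. by apply/nonincreasing_seqP; exact: window_max_noninc. Qed.

(** Each Krasnosel'skii-Mann step lowers the squared distance to a fixed point
    by [lambda * (1 - lambda) * r k ^+ 2], so infinitely many consecutive ones
    cannot all have a residual above a positive threshold. *)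
Lemma all_rejected_small_residual us K (e : R) : G us = us ->
  (forall k, (K <= k)%N -> ~~ accepted k) -> 0 < e ->
  exists2 k, (K <= k)%N & r k <= e.
Proof.
move=> fix_us no e0; have /andP[l0 l1] := lambda01; apply: contrapT => big.
pose E k := enorm (u k - us) ^+ 2; pose delta := lambda * (1 - lambda) * e ^+ 2.
have delta0 : 0 < delta by rewrite !mulr_gt0 ?subr_gt0// exprn_gt0.
have step k : (K <= k)%N -> E k.+1 <= E k - delta.
  move=> Kk; rewrite /E (rejected_update (no _ Kk)).
  have -> : (1 - lambda) *: u k + lambda *: G (u k) - us =
      (1 - lambda) *: (u k - us) + lambda *: (G (u k) - us).
    by apply/matrixP => i j; rewrite !mxE; ring.
  rewrite sqr_enorm_convex opprB addrA subrK -/(residual G (u k)).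
  have : enorm (G (u k) - us) ^+ 2 <= enorm (u k - us) ^+ 2.
    by rewrite ler_sqr ?nnegrE ?enorm_ge0// -{1}fix_us neG.
  move/(ler_wpM2l (ltW l0)).
  have : e ^+ 2 <= r k ^+ 2.
    rewrite ler_sqr ?nnegrE ?enorm_ge0 ?(ltW e0)// leNgt; apply/negP => rk.
    by apply: big; exists k => //; exact: ltW.
  have l2 : 0 <= lambda * (1 - lambda) by rewrite mulr_ge0 ?subr_ge0// ltW.
  move/(ler_wpM2l l2); rewrite -/delta; lra.
have descent p : E (K + p)%N <= E K - p%:R * delta.
  elim: p => [|p IH]; first by rewrite addn0 mul0r subr0.
  rewrite addnS; apply: le_trans (step _ (leq_addr _ _)) _.
  rewrite -natr1 mulrDl mul1r; lra.
have EK : 0 <= E K / delta by rewrite divr_ge0 ?sqr_ge0// ltW.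
have := archi_boundP EK; set p := Num.bound _; rewrite ltr_pdivrMr// => Kp.
by have := descent p; have : 0 <= E (K + p)%N := sqr_ge0 _; lra.
Qed.

(** Suppose that accepted steps contract the window maximum by [g].  An accepted
    step followed by a rejected one restarts the window from a contracted
    residual; if this does not happen after [K] and some later step is accepted,
    all steps after it are accepted and the window is renewed in [m.+1] of them;
    otherwise all later steps are rejected. *)
Lemma window_max_contracts us (g : R) K : G us = us -> 0 < g ->
  (forall k, gamma k <= g) -> exists k, W k <= g * W K.
Proof.
move=> fix_us g0 gg.
have contr k : (K <= k)%N -> accepted k -> r k.+1 <= g * W K.
  move=> Kk ok; apply: le_trans (accepted_residual ok) _.
  apply: le_trans (ler_wpM2r (window_max_ge0 _ _ _ _ _) (gg k)) _.
  by rewrite ler_pM2l// window_max_homo.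
have [[k Kk [ok no]]|persist] :=
    pselect (exists2 k, (K <= k)%N & accepted k /\ ~~ accepted k.+1).
  by exists k.+2; apply: le_trans (rejected_window no) (contr _ Kk ok).
have [[k Kk ok]|none] := pselect (exists2 k, (K <= k)%N & accepted k).
  have oks p : accepted (k + p).
    elim: p => [|p IH]; first by rewrite addn0.
    rewrite addnS; apply: contrapT => /negP no; apply: persist.
    by exists (k + p)%N => //; rewrite (leq_trans Kk) ?leq_addr.
  exists (k + m.+1)%N; apply: window_max_le.
    by rewrite mulr_ge0 ?window_max_ge0// ltW.
  move=> i /andP[ik _]; have dm := depth_le_size m kappa (k + m.+1).
  have -> : i = (k + (i - k.+1)).+1 by lia.
  by apply: contr => //; rewrite (leq_trans Kk) ?leq_addr.
have [||k Kk rk] := @all_rejected_small_residual us K (g * W K) fix_us.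
- by move=> k Kk; apply/negP => ok; apply: none; exists k.
- by rewrite mulr_gt0// window_max_gt0.
exists k.+1; apply: le_trans (rejected_window _) rk.
by apply/negP => ok; apply: none; exists k.
Qed.

(** If the window maxima stayed above [l > 0], the choice of [gamma] would make
    every accepted step contract by the fixed factor [1 - l / (2 * W 0)]. *)
Lemma window_max_cvg0 us : G us = us -> (fun k => W k) @ \oo --> (0 : R).
Proof.
move=> fix_us; have noninc := window_max_homo.
have cvgW : cvgn (fun k => W k).
  apply: nonincreasing_is_cvgn => //.
  by exists 0 => _ [k _ <-]; exact: window_max_ge0.
set l := limn (fun k => W k).
have lW k : l <= W k by apply: nonincreasing_cvgn_ge noninc cvgW k.
suff <- : l = 0 by [].
have l0 : 0 <= l by apply: limr_ge => //; near=> k; exact: window_max_ge0.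
apply/eqP; rewrite eq_le l0 andbT leNgt; apply/negP => lgt0.
have W0 := window_max_gt0 0; pose q := l / (2 * W 0%N).
have q0 : 0 < q by rewrite divr_gt0// mulr_gt0.
have q1 : q < 1 by rewrite ltr_pdivrMr ?mulr_gt0//; have := lW 0%N; lra.
have gg k : gamma k <= 1 - q.
  apply: le_trans (gamma_le k) _.
  by rewrite lerB// ler_pM2r ?invr_gt0 ?mulr_gt0.
have lK K : l <= (1 - q) * W K.
  have [|k Wk] := window_max_contracts K fix_us _ gg; first by rewrite subr_gt0.
  exact: le_trans (lW k) Wk.
have : l / (1 - q) <= l.
  by apply: limr_ge => //; near=> K; rewrite ler_pdivrMr ?subr_gt0// mulrC.
rewrite ler_pdivrMr ?subr_gt0//.
have : 0 < q * l by rewrite mulr_gt0.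
lra.
Unshelve. all: by end_near. Qed.

Lemma residual_cvg0 us : G us = us -> (fun k => r k) @ \oo --> (0 : R).
Proof.
move=> fix_us; apply: (squeeze_cvgr _ (cvg_cst 0) (window_max_cvg0 fix_us)).
by near=> k; rewrite enorm_ge0 residual_le_window.
Unshelve. all: by end_near. Qed.

(** * Local convergence and rates *)

Variables (us : 'cV[R]_n) (c : R) (D : set 'cV[R]_n) (M : R).
Hypothesis fix_us : G us = us.
Hypothesis c01 : 0 < c < 1.
Hypothesis nbhsD : nbhs us D.
Hypothesis ctrD : contractive_on G D c.
Hypothesis dG : differentiable G us.
Hypothesis M_ge1 : 1 <= M.
Hypothesis alphaM : forall k : nat, (1 <= k)%N ->
  [/\ enorm (AA_residual G m u kappa k (alpha k)) <= r k,
      \sum_(j < (d k).+1) alpha k j = 1 &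
      \sum_(j < (d k).+1) `|alpha k j| <= M].

(** The window residuals weighted by the coefficients: the first-order error of
    an accelerated step is a small multiple of this sum. *)
Local Notation S k :=
  (\sum_(j < (d k).+1) `|alpha k j| * r (k - d k + j)%N).

Lemma near_dist_le_residual :
  \forall k \near \oo, enorm (u k - us) <= r k / (1 - c).
Proof.
have /andP[c0 c1] := c01.
have [rho rho0 ctr] := contractive_near_fixpoint fix_us nbhsD ctrD.
have w0 : 0 < (1 - c) * rho / 2 by rewrite divr_gt0// mulr_gt0// subr_gt0.
have /cvgr0Pnorm_le := residual_cvg0 fix_us; move=> /(_ _ w0).
apply: filterS => k; rewrite ger0_norm ?enorm_ge0//= => rk.
by apply: (dist_le_residual neG c01 rho0 ctr); lra.
Qed.

Lemma iterates_cvg : u @ \oo --> us.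
Proof.
have /andP[c0 c1] := c01; apply/cvgrPdist_le => e e0.
have w0 : 0 < (1 - c) * e by rewrite mulr_gt0// subr_gt0.
have /cvgr0Pnorm_le := residual_cvg0 fix_us; move=> /(_ _ w0) small.
have close := near_dist_le_residual; near=> k.
rewrite distrC; apply: le_trans (norm_le_enorm _) _.
have uk : enorm (u k - us) <= r k / (1 - c) by near: k.
apply: le_trans uk _; rewrite ler_pdivrMr ?subr_gt0// mulrC.
by apply: le_trans (ler_norm _) _; near: k.
Unshelve. all: by end_near. Qed.

Lemma weighted_residual_le k : (1 <= k)%N -> S k <= M * W k.
Proof.
move=> k1; have [_ _ aM] := alphaM k1.
apply: le_trans (ler_wpM2r (window_max_ge0 _ _ _ _ _) aM).
rewrite mulr_suml; apply: ler_sum => j _; rewrite ler_wpM2l//.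
exact: entry_le_window_max.
Qed.

(** With [v] the older and [w] the current residual and [a0] the coefficient of
    [v], the combined residual is [w + a0 *: (v - w)].  Its norm being at most
    that of [w], [`|a0| * enorm (v - w)] is at most twice the norm of [w], and so
    [`|a0| * enorm v] is of the order of [enorm w] even when [v] is far larger
    than [w]. *)
Lemma weighted_residual_le_depth1 k : m = 1%N -> (1 <= k)%N ->
  S k <= (2 + M) * r k.
Proof.
move=> m1 k1; have := depth_le_size m kappa k; rewrite {2}m1.
have [] := alphaM k1; rewrite /AA_residual => + + + d1; move: d1.
case: (d k) => [_|[_|//]].
  rewrite !big_ord1 subn0 addn0 => _ _ aM.
  have := ler_wpM2r (enorm_ge0 (residual G (u k))) aM.
  have := enorm_ge0 (residual G (u k)); lra.
rewrite !big_ord_recl !big_ord0 /= !addr0 /bump/=.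
rewrite !addn0 subnK// subn1.
set a0 := alpha k 0%N; set a1 := alpha k 1%N; set v := residual G (u k.-1).
set w := residual G (u k) => ls suma aM.
have : `|a0| * enorm (v - w) <= 2 * enorm w.
  rewrite -enormZ (_ : _ *: _ = a0 *: v + a1 *: w - w).
    by apply: le_trans (enormBD _ _) _; lra.
  have -> : a1 = 1 - a0 by lra.
  by apply/matrixP => i j; rewrite !mxE; ring.
have : enorm v <= enorm (v - w) + enorm w.
  by rewrite -{1}(subrK w v); exact: enormD.
move/(ler_wpM2l (normr_ge0 a0)); have := ler_wpM2r (enorm_ge0 w) aM; lra.
Qed.

Lemma accelerated_residual e : 0 < e -> \forall k \near \oo,
  enorm (residual G (u_AA G m u kappa alpha k)) <= c * r k + e * S k.
Proof.
move=> e0; have /andP[c0 c1] := c01; have c1' : 0 < 1 - c by rewrite subr_gt0.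
have M0 : 0 < M by exact: lt_le_trans ltr01 M_ge1.
have [rho rho0 ctr] := contractive_near_fixpoint fix_us nbhsD ctrD.
have cA := diff_contraction fix_us dG rho0 ctr.
(* [1 - c] turns distances into residuals; the two remainder terms of
   [residual_combination] account for the half *)
have e'0 : 0 < e * (1 - c) / 2 by rewrite divr_gt0// mulr_gt0.
have [delta delta0 rem_small] := differentiable_enorm fix_us dG e'0.
have w1 : 0 < (1 - c) * rho / 2 by rewrite divr_gt0// mulr_gt0.
have w2 : 0 < (1 - c) * delta / M by rewrite divr_gt0// mulr_gt0.
have /cvgr0Pnorm_le W0 := window_max_cvg0 fix_us.
have := W0 _ w1; have := W0 _ w2 => near2 near1; near=> k.
have k1 : (1 <= k)%N by near: k; exists 1%N.
have Wrho : W k <= (1 - c) * rho / 2.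
  by apply: le_trans (ler_norm _) _; near: k.
have Wdelta : W k * M <= (1 - c) * delta.
  by rewrite -ler_pdivlMr//; apply: le_trans (ler_norm _) _; near: k.
have [ls suma aM] := alphaM k1.
have dist j : (j < (d k).+1)%N ->
    enorm (u (k - d k + j)%N - us) <= r (k - d k + j)%N / (1 - c).
  move=> jd; apply: (dist_le_residual neG c01 rho0 ctr).
  have := entry_le_window_max G u jd.
  lra.
pose x j := u (k - d k + j)%N.
have sum_dist : \sum_(j < (d k).+1) `|alpha k j| * enorm (x j - us) <=
    S k / (1 - c).
  rewrite mulr_suml; apply: ler_sum => j _.
  by rewrite -mulrA ler_wpM2l// dist.
have SM := weighted_residual_le k1.
have := residual_combination neG fix_us (a := alpha k) (x := x) cA (ltW e'0)
  rem_small suma.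
rewrite -/(AA_residual G m u kappa k (alpha k)).
rewrite -/(AA_update G m u kappa k (alpha k)) -/(u_AA G m u kappa alpha k).
move=> bound; apply: le_trans (bound _ _) _.
- move=> j jd; apply: le_trans (dist j jd) _; rewrite ler_pdivrMr//.
  have := entry_le_window_max G u jd.
  have := ler_peMr (window_max_ge0 G m u kappa k) M_ge1; lra.
- by apply: le_trans sum_dist _; rewrite ler_pdivrMr//; lra.
have := ler_wpM2l (ltW e'0) sum_dist; have := ler_wpM2l (ltW c0) ls.
have -> : e * (1 - c) / 2 * (S k / (1 - c)) = e * S k / 2.
  by field; rewrite gt_eqF.
lra.
Unshelve. all: by end_near. Qed.

(** An accelerated step comes within a factor close to [c < 1] of the window
    maximum, whereas the factor [gamma k] required for acceptance tends to [1].
*)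
Lemma near_accepted : \forall k \near \oo, accepted k.
Proof.
have /andP[c0 c1] := c01; have c1' : 0 < 1 - c by rewrite subr_gt0.
have M0 : 0 < M by exact: lt_le_trans ltr01 M_ge1.
have W0 := window_max_gt0 0%N.
(* this choice bounds the accelerated residual by [(1 + c) / 2 * W k] *)
have e0 : 0 < (1 - c) / (2 * M) by rewrite divr_gt0// mulr_gt0.
have w0 : 0 < (1 - c) * W 0%N by rewrite mulr_gt0.
have step := accelerated_residual e0.
have /cvgr0Pnorm_le := window_max_cvg0 fix_us; move=> /(_ _ w0) small.
have /archi_boundP : 0 <= 2 / (1 - c) by rewrite divr_ge0// ltW.
set N := Num.bound _ => boundN; near=> k.
have k1 : (1 <= k)%N by near: k; exists 1%N.
have Wk : W k <= (1 - c) * W 0%N by apply: le_trans (ler_norm _) _; near: k.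
have gk : (1 + c) / 2 <= gamma k.
  rewrite gammaE lerBrDr -lerBrDl ge_max; apply/andP; split.
    rewrite ler_pdivrMr ?ltr0n ?addn2//.
    have : N%:R <= k.+2%:R :> R.
      by rewrite ler_nat ltnW// ltnW// ltnS ltnW//; near: k; exists N.+1.
    move/(lt_le_trans boundN); rewrite ltr_pdivrMr//; lra.
  rewrite ler_pdivrMr ?mulr_gt0//; lra.
rewrite /AA_accepted.
have uk : enorm (residual G (u_AA G m u kappa alpha k)) <=
    c * r k + (1 - c) / (2 * M) * S k by near: k.
apply: le_trans uk _.
apply: le_trans (ler_wpM2r (window_max_ge0 _ _ _ _ _) gk).
have := ler_wpM2l (ltW e0) (weighted_residual_le k1).
have -> : (1 - c) / (2 * M) * (M * W k) = (1 - c) / 2 * W k.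
  by field; rewrite gt_eqF.
have := ler_wpM2l (ltW c0) (residual_le_window k); lra.
Unshelve. all: by end_near. Qed.

Lemma near_residual_step e : 0 < e ->
  \forall k \near \oo, r k.+1 <= c * r k + e * S k.
Proof.
move=> e0; have acc := near_accepted; have step := accelerated_residual e0.
near=> k; have ok : accepted k by near: k.
by rewrite (GlobAA_u run) ok; near: k.
Unshelve. all: by end_near. Qed.

Lemma residual_geometric q : c < q -> q < 1 -> exists C, forall k,
  r k <= C * q ^+ k.
Proof.
move=> cq q1; have /andP[c0 c1] := c01; have q0 := lt_trans c0 cq.
have M0 : 0 < M by exact: lt_le_trans ltr01 M_ge1.
pose e := q ^+ m * (q - c).
have e0 : 0 < e by rewrite mulr_gt0 ?exprn_gt0 ?subr_gt0.
have eM0 : 0 < e / M by rewrite divr_gt0.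
have [K _ stepK] := near_residual_step eM0.
apply: (@geometric_decay R (fun k => r k) (fun k => W k) c q e m K.+1) => //
  [|||k|k x x0 rx|k Kk].
- exact: ltW.
- by rewrite q0 ltW.
- exact: ltW.
- exact: enorm_ge0.
- apply: window_max_le => // i ik; apply: rx.
  by have := depth_le_size m kappa k; lia.
apply: le_trans (stepK _ (ltnW Kk)) _; rewrite lerD2l.
have k1 : (1 <= k)%N by exact: leq_trans Kk.
apply: le_trans (ler_wpM2l (ltW eM0) (weighted_residual_le k1)) _.
by rewrite mulrA divfK// gt_eqF.
Qed.

Lemma residual_root_rate : (limn_esup (fun k =>
  ((r k / r 0%N) `^ k%:R^-1)%:E) <= c%:E)%E.
Proof.
apply: (limn_esup_root_le (r := fun k => r k)) => // [|k|q cq q1].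
- exact: residual_gt0.
- exact: enorm_ge0.
by have [C rC] := residual_geometric cq q1; exists C; near=> k; exact: rC.
Unshelve. all: by end_near. Qed.

Lemma dist_root_rate : (limn_esup (fun k =>
  ((enorm (u k - us) / enorm (u 0%N - us)) `^ k%:R^-1)%:E) <= c%:E)%E.
Proof.
have /andP[c0 c1] := c01.
apply: (limn_esup_root_le (r := fun k => enorm (u k - us))) => // [|k|q cq q1].
- apply: enorm_gt0 => /eqP; rewrite subr_eq0 => /eqP u0E.
  by apply: (@nonstop 0%N); rewrite u0E /residual fix_us subrr.
- exact: enorm_ge0.
have [C rC] := residual_geometric cq q1; exists (C / (1 - c)).
have close := near_dist_le_residual; near=> k.
have uk : enorm (u k - us) <= r k / (1 - c) by near: k.
by apply: le_trans uk _; rewrite mulrAC ler_pM2r ?invr_gt0 ?subr_gt0.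
Unshelve. all: by end_near. Qed.

Lemma residual_ratio_rate : m = 1%N ->
  (limn_esup (fun k => (r k.+1 / r k)%:E) <= c%:E)%E.
Proof.
move=> m1; have /andP[c0 c1] := c01; apply: limn_esup_le => // q cq q1.
have M2 : 0 < 2 + M by have := M_ge1; lra.
have e0 : 0 < (q - c) / (2 + M) by rewrite divr_gt0// subr_gt0.
have step := near_residual_step e0; near=> k.
have k1 : (1 <= k)%N by near: k; exists 1%N.
rewrite ler_pdivrMr ?residual_gt0//.
have rk : r k.+1 <= c * r k + (q - c) / (2 + M) * S k by near: k.
apply: le_trans rk _.
have := ler_wpM2l (ltW e0) (weighted_residual_le_depth1 m1 k1).
rewrite mulrA divfK ?gt_eqF//; lra.
Unshelve. all: by end_near. Qed.

End GlobalConvergence.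

Theorem theorem2p17 (R : realType) (n : nat) (G : 'cV[R]_n -> 'cV[R]_n)
    (m : nat) (lambda : R) (u0 : 'cV[R]_n)
    (u : nat -> 'cV[R]_n) (kappa : nat -> nat) (alpha : nat -> nat -> R)
    (gamma : nat -> R)
    (m_ge1 : (1 <= m)%N) (lambda01 : 0 < lambda < 1)
    (run : GlobAA G m u kappa alpha gamma lambda u0)
    (gammaE : forall k : nat, gamma k =
       1 - Num.max (1 / (k + 2)%:R)
                   (window_max G m u kappa k /
                    (2 * window_max G m u kappa 0%N)))
    (nonstop : forall k : nat, residual G (u k) <> 0) :
  (nonexpansive G -> (exists ustar : 'cV[R]_n, G ustar = ustar) ->
     (fun k : nat => enorm (residual G (u k))) @ \oo --> (0 : R)) /\
  (forall (ustar : 'cV[R]_n) (c : R) (D : set 'cV[R]_n),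
     nonexpansive G -> G ustar = ustar ->
     0 < c < 1 -> nbhs ustar D -> contractive_on G D c ->
     (forall v : 'cV[R]_n, G v = v -> v = ustar) /\
     (forall Malpha : R,
        differentiable G ustar ->
        1 <= Malpha ->
        (forall k : nat, (1 <= k)%N ->
           [/\ enorm (AA_residual G m u kappa k (alpha k))
                 <= enorm (residual G (u k)),
               \sum_(j < (depth m kappa k).+1) alpha k j = 1 &
               \sum_(j < (depth m kappa k).+1) `|alpha k j| <= Malpha]) ->
        [/\ (fun k : nat => enorm (residual G (u k))) @ \oo --> (0 : R)
              /\ u @ \oo --> ustar,
            exists K0 : nat, forall k : nat, (K0 <= k)%N ->
              enorm (residual G (u_AA G m u kappa alpha k))
                <= gamma k * window_max G m u kappa k
              /\ u k.+1 = u_AA G m u kappa alpha k,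
            (limn_esup (fun k : nat =>
               ((enorm (residual G (u k)) / enorm (residual G (u 0%N)))
                  `^ (k%:R^-1))%:E) <= c%:E)%E,
            (limn_esup (fun k : nat =>
               ((enorm (u k - ustar) / enorm (u 0%N - ustar))
                  `^ (k%:R^-1))%:E) <= c%:E)%E &
            m = 1%N ->
            (limn_esup (fun k : nat =>
               (enorm (residual G (u k.+1)) / enorm (residual G (u k)))%:E)
               <= c%:E)%E])).
Proof.
split=> [neG [us fix_us]|us c D neG fix_us c01 nbhsD ctrD].
  exact: (residual_cvg0 lambda01 run gammaE nonstop neG fix_us).
split=> [v fix_v|M dG M_ge1 alphaM].
  have [rho rho0 ctr] := contractive_near_fixpoint fix_us nbhsD ctrD.
  exact: (fixpoint_unique neG c01 rho0 ctr).
split.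
- split; first exact: (residual_cvg0 lambda01 run gammaE nonstop neG fix_us).
  exact: (iterates_cvg lambda01 run gammaE nonstop neG fix_us c01 nbhsD ctrD).
- have [K0 _ acc] := near_accepted lambda01 run gammaE nonstop neG fix_us c01
    nbhsD ctrD dG M_ge1 alphaM.
  exists K0 => k /acc /= ok; split; first exact: ok.
  by rewrite (GlobAA_u run) ok.
- exact: (residual_root_rate lambda01 run gammaE nonstop neG fix_us c01 nbhsD
    ctrD dG M_ge1 alphaM).
- exact: (dist_root_rate lambda01 run gammaE nonstop neG fix_us c01 nbhsD
    ctrD dG M_ge1 alphaM).
exact: (residual_ratio_rate lambda01 run gammaE nonstop neG fix_us c01 nbhsD
  ctrD dG M_ge1 alphaM).
Qed.
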